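(* Let $\mathcal{G}$ and $\mathcal{H}$ be ultragraphs without sinks, with associated ultragraph shift spaces $X_{\mathcal{G}}$ and $X_{\mathcal{H}}$. Suppose that $\Phi:X_{\mathcal{G}}\to X_{\mathcal{H}}$ is a map such that for all $B\in\mathfrak{p}^0_{\mathcal{H}\,min}$ the set $C_B:=\Phi^{-1}(BBB\ldots)$ is a finitely defined set. Then $\Phi$ is continuous and shift commuting if, and only if, $\Phi$ is a generalized sliding block code given by $$\bigl(\Phi(x)\bigr)_n=\sum_{a\in \mathbf{A}_{\mathcal{H}}}a\,\mathbf{1}_{C_a}\circ\sigma^{n-1}(x)\quad (x\in X_{\mathcal{G}},\ n\ge1)$$ where: (i) for all $a\in\mathcal{H}^1$, the set $C_a$ is a (possibly empty) union of generalized cylinders of $X_{\mathcal{G}}$; (ii) if $\bar x=(\bar x_1\ldots\bar x_{|\bar x|}AAA\ldots)\in X^{fin}_{\mathcal{G}}$ is such that $\Phi(\bar x)=(BBB\ldots)\in X^0_{\mathcal{H}}$, then: (a) there exists a finite subset $F\subseteq\varepsilon(A)$ such that, for all $e\in\varepsilon(A)\setminus F$, if $x\in X_{\mathcal{G}}$ satisfies $x_i=\bar x_i$ for all $i=1,\ldots,|\bar x|$ and $x_{|\bar x|+1}=e$, then $(\Phi(x))_1=B$ or $(\Phi(x))_1\in\varepsilon(B)$, i.e., $\Phi(x)\in D_B$; (b) for all $x\in X_{\mathcal{G}}$ with $x_i=\bar x_i$ for $i=1,\ldots,|\bar x|$, $x_{|\bar x|+1}\in\varepsilon(A)$, and $(\Phi(x))_1\in\varepsilon(B)$,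 the set $$A_x:=\{g\in\varepsilon(A):\ \text{there exists } y\in X_{\mathcal{G}} \text{ with } y_i=\bar x_i \text{ for } i=1,\ldots,|\bar x|,\ y_{|\bar x|+1}=g,\text{ and } (\Phi(y))_1=(\Phi(x))_1\}$$ is finite; (iii) if $(AAA\ldots)\in X^0_{\mathcal{G}}$ is such that $\Phi(AAA\ldots)=(ddd\ldots)\in X_{\mathcal{H}}^{inf}$, then for all integers $M\geq1$ there exists a generalized cylinder $D_{A,F}$, with $F\subseteq\varepsilon(A)$ finite, such that $\sigma^i(D_{A,F})\subseteq C_d$ for all $i=0,1,\ldots,M$.
   Context: An ultragraph is a quadruple $\mathcal{G}=(G^0,\mathcal{G}^1,r,s)$ with a set of vertices $G^0$, a set of edges $\mathcal{G}^1$, a source map $s:\mathcal{G}^1\to G^0$ and a range map $r:\mathcal{G}^1\to P(G^0)\setminus\{\emptyset\}$. It has no sinks if every vertex $v$ satisfies $s^{-1}(v)\neq\emptyset$. $\mathcal{G}^0$ is the smallest subset of $P(G^0)$ containing all $\{v\}$ ($v\in G^0$) and all $r(e)$ ($e\in\mathcal{G}^1$), closed under finite unions and under non-empty finite intersections. For $A\subseteq G^0$, $\varepsilon(A)=\{e\in\mathcal{G}^1: s(e)\in A\}$. $A\in\mathcal{G}^0$ is an infinite emitter if $\varepsilon(A)$ is infinite, and a minimal infinite emitter if moreover no proper subset of $A$ belonging to $\mathcal{G}^0$ is an infinite emitter. $\mathfrak{p}^0_{\mathcal{G}\,min}$ denotes the set of minimal infinite emitters. A finite path of length $n\geq1$ is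 $\alpha=\alpha_1\ldots\alpha_n$ with $\alpha_i\in\mathcal{G}^1$ and $s(\alpha_{i+1})\in r(\alpha_i)$ for $1\le i<n$; $r(\alpha)=r(\alpha_n)$. The ultrapath space $\mathfrak{p}_{\mathcal{G}}$ consists of the elements $A\in\mathcal{G}^0$ (length $0$, $r(A)=A$) and the pairs $(\alpha,A)$ with $\alpha$ a finite path of length $n\ge1$ and $A\in\mathcal{G}^0$, $A\subseteq r(\alpha)$ (length $n$, $r((\alpha,A))=A$). $X_{\mathcal{G}}^{inf}$ is the set of infinite paths $(\gamma_i)_{i\ge1}$, $\gamma_i\in\mathcal{G}^1$, $s(\gamma_{i+1})\in r(\gamma_i)$ (length $\infty$). $X_{\mathcal{G}}^{fin}$ is the set of sequences $(\alpha_1\ldots\alpha_kAAA\ldots)$, $k\geq 0$, where $A$ is a minimal infinite emitter and, if $k\ge1$, $\alpha_1\ldots\alpha_k$ is a finite path with $A\subseteq r(\alpha_k)$; such a sequence has length $k$. $X_{\mathcal{G}}^0$ is the set of length-$0$ sequences $(AAA\ldots)$. The shift space is $X_{\mathcal{G}}=X_{\mathcal{G}}^{fin}\cup X_{\mathcal{G}}^{inf}$, with shift map $\sigma((x_i)_{i\ge1})=(x_{i+1})_{i\ge1}$; $|x|$ denotes the length of $x$. The alphabet is $\mathbf{A}_{\mathcal{G}}=\mathcal{G}^1\cup\mathfrak{p}^0_{\mathcal{G}\,min}$. The same notation is used for $\mathcal{H}$. An ultrapath $A\in\mathcal{G}^0$ is a prefix of $x\in X_{\mathcal{G}}$ if either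 $x_1\in\mathcal{G}^1$ and $s(x_1)\in A$, or $x_1$ is a minimal infinite emitter contained in $A$. An ultrapath $(\gamma_1\ldots\gamma_n,A)$ is a prefix of $x$ if $x_i=\gamma_i$ for $1\le i\le n$ and $A$ is a prefix of $\sigma^n(x)$. The topology on $X_{\mathcal{G}}$ is generated by the generalized cylinders $D_{\mathbf{y},F}=\{x\in X_{\mathcal{G}}:\mathbf{y}\text{ is a prefix of }x\text{ and }x_{|\mathbf{y}|+1}\notin F\}$, with $\mathbf{y}\in\mathfrak{p}_{\mathcal{G}}$ and $F$ a finite (possibly empty) subset of $\varepsilon(r(\mathbf{y}))$; $D_{\mathbf{y}}=D_{\mathbf{y},\emptyset}$. A block of length $n\ge1$ in $X_{\mathcal{G}}$ is a word $a_1\ldots a_n\in(\mathbf{A}_{\mathcal{G}})^n$ occurring as $n$ consecutive entries of some $x\in X_{\mathcal{G}}$. A pseudo cylinder is the empty set or a set $[b]_k^\ell=\{x\in X_{\mathcal{G}}:(x_k\ldots x_\ell)=b\}$ with $1\le k\le\ell$ and $b$ a block. A set $C\subseteq X_{\mathcal{G}}$ is finitely defined if both $C$ and its complement $C^c$ are unions (of arbitrary families) of pseudo cylinders. A map $\Phi:X_{\mathcal{G}}\to X_{\mathcal{H}}$ is shift commuting if $\Phi\circ\sigma=\sigma\circ\Phi$. It is a generalized sliding block code if $(\Phi(x))_n=\sum_{a\in\mathbf{A}_{\mathcal{H}}}a\mathbf{1}_{C_a}\circ\sigma^{n-1}(x)$ for all $x\in X_{\mathcal{G}}$, $n\ge1$,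 where $\{C_a\}_{a\in\mathbf{A}_{\mathcal{H}}}$ is a partition of $X_{\mathcal{G}}$ by finitely defined sets. Here a partition is a family of pairwise disjoint (possibly empty) sets with union $X_{\mathcal{G}}$, and the sum is symbolic: $(\Phi(x))_n=a$ for the unique $a$ with $\sigma^{n-1}(x)\in C_a$. *)

(* Defs.v *)
From HB Require Import structures.
From mathcomp Require Import all_boot.
From mathcomp Require Import boolp classical_sets cardinality topology.

Set Implicit Arguments.
Unset Strict Implicit.
Unset Printing Implicit Defensive.

Local Open Scope classical_set_scope.

Record ultragraph := Ultragraph {
  vertex : Type;
  edge : Type;
  src : edge -> vertex;
  rng : edge -> set vertex;
  rng_neq0 : forall e, rng e !=set0
}.
Arguments src {u} _.
Arguments rng {u} _ _.

Definition no_sinks (G : ultragraph) :=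
  forall v : vertex G, exists e : edge G, src e = v.

Section ultragraph_shift.
Variable G : ultragraph.
Implicit Types (A B : set (vertex G)) (e f : edge G) (al : seq (edge G)).

(* Intersections are required to stay in the family only when they are
   nonempty. *)
Definition lattice_closed (M : set (set (vertex G))) :=
  (forall A B, M A -> M B -> M (A `|` B)) /\
  (forall A B, M A -> M B -> A `&` B !=set0 -> M (A `&` B)).

Definition gen_vertices : set (set (vertex G)) :=
  smallest lattice_closed
    (range (fun v : vertex G => [set v]) `|` range (@rng G)).

Definition emitted A : set (edge G) := [set e | A (src e)].

Definition infinite_emitter A := gen_vertices A /\ infinite_set (emitted A).

Definition min_infinite_emitter : set (set (vertex G)) :=
  [set A | infinite_emitter A /\
           forall B, gen_vertices B -> B `<` A -> ~ infinite_emitter B].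

Definition min_emitter : Type := set_type min_infinite_emitter.

Definition emitter_set (A : min_emitter) : set (vertex G) := val A.

Definition alphabet : Type := (edge G + min_emitter)%type.

Definition is_path al : bool := sorted (fun e f => `[< rng e (src f) >]) al.

(* The condition A `<=` r(al); it is void when al is empty. *)
Definition in_range al A : Prop :=
  if al is e :: al' then A `<=` rng (last e al') else True.

(* ([::], A) stands for the ultrapath A of length 0, and (al, A) with al
   nonempty for the ultrapath (al, A) of length [size al]. *)
Definition ultrapath : set (seq (edge G) * set (vertex G)) :=
  [set y | [/\ is_path y.1, gen_vertices y.2 & in_range y.1 y.2]].

(* Sequences are indexed from 0: [x n] is the letter x_{n+1}. *)
Definition fin_word al (A : min_emitter) : nat -> alphabet :=
  fun i => nth (inr A) [seq inl e | e <- al] i.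

Definition fin_seqs : set (nat -> alphabet) :=
  [set x | exists al (A : min_emitter),
     [/\ is_path al, in_range al (emitter_set A) & x = fin_word al A]].

Definition inf_seqs : set (nat -> alphabet) :=
  [set x | exists2 g : nat -> edge G,
     forall i, rng (g i) (src (g i.+1)) & x = inl \o g].

Record ushift := UShift {
  letters :> nat -> alphabet;
  lettersP : (fin_seqs `|` inf_seqs) letters
}.

Lemma shift_subproof (x : ushift) :
  (fin_seqs `|` inf_seqs) (fun i => x i.+1).
Proof.
case: (lettersP x) => [[al [A [pal Aal xE]]]|[g gP xE]].
- left; exists (behead al), A; split.
  + by case: al pal {Aal xE} => [|e [|f al]] //= /andP[].
  + by case: al Aal {pal xE} => [|e [|f al]].
  + by rewrite xE; apply/funext => i; case: al {pal Aal xE} => //=;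
      rewrite /fin_word !nth_nil.
- by right; exists (fun i => g i.+1) => //; rewrite xE.
Qed.

Definition shift (x : ushift) : ushift := UShift (shift_subproof x).

Lemma const_pt_subproof (A : min_emitter) :
  (fin_seqs `|` inf_seqs) (fun=> inr A).
Proof.
left; exists [::], A; split => //.
by apply/funext => i; rewrite /fin_word nth_nil.
Qed.

(* The sequence (AAA...) of length 0. *)
Definition const_pt (A : min_emitter) : ushift := UShift (const_pt_subproof A).

Definition prefix0 A (x : ushift) : Prop :=
  match x 0 with
  | inl e => A (src e)
  | inr B => emitter_set B `<=` A
  end.

(* The letters x_(k+1) ... x_(k+n). *)
Definition window (x : ushift) k n : seq alphabet := [seq x i | i <- iota k n].

Definition is_prefix (y : seq (edge G) * set (vertex G)) (x : ushift) : Prop :=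
  window x 0 (size y.1) = [seq inl e | e <- y.1] /\
  prefix0 y.2 (iter (size y.1) shift x).

Definition cylinder (y : seq (edge G) * set (vertex G)) (F : set (edge G)) :
    set ushift :=
  [set x | is_prefix y x /\ ~ (inl @` F) (x (size y.1))].

Definition gen_cylinder : set (set ushift) :=
  [set D | exists y F,
     [/\ ultrapath y, finite_set F, F `<=` emitted y.2 & D = cylinder y F]].

HB.instance Definition _ := gen_eqMixin ushift.
HB.instance Definition _ := gen_choiceMixin ushift.
HB.instance Definition _ :=
  @isSubBaseTopological.Build ushift (set ushift) gen_cylinder id.

Definition is_block (b : seq alphabet) : Prop :=
  (0 < size b)%N /\ exists (x : ushift) k, window x k (size b) = b.

(* With 0-based k, this is [b]_(k+1)^l for l = k + size b. *)
Definition pseudo_cylinder : set (set ushift) :=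
  [set P | P = set0 \/
     exists k b, is_block b /\ P = [set x | window x k (size b) = b]].

Definition union_of (K : set (set ushift)) (C : set ushift) : Prop :=
  exists2 K' : set (set ushift), K' `<=` K & C = \bigcup_(P in K') P.

Definition finitely_defined (C : set ushift) : Prop :=
  union_of pseudo_cylinder C /\ union_of pseudo_cylinder (~` C).

End ultragraph_shift.

Arguments gen_cylinder {G} _.

Section sliding_block_codes.
Variables G H : ultragraph.

Definition shift_commuting (Phi : ushift G -> ushift H) : Prop :=
  Phi \o @shift G = @shift H \o Phi.

(* Parts are allowed to be empty. *)
Definition is_partition (C : alphabet H -> set (ushift G)) : Prop :=
  trivIset setT C /\ \bigcup_a C a = setT.

(* The symbolic sum: the letter Phi(x)_(n+1) is the unique a such that
   sigma^n(x) is in C a. *)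
Definition gen_sliding_block_code (Phi : ushift G -> ushift H)
    (C : alphabet H -> set (ushift G)) : Prop :=
  [/\ is_partition C, forall a, finitely_defined (C a) &
      forall (x : ushift G) n a, Phi x n = a <-> C a (iter n (@shift G) x)].

End sliding_block_codes.

(* Main.v *)
(* A point of infinite length has the sets of points agreeing with it on a finite
   window as neighbourhood base; a finite point alpha A A A ... has the cylinders
   D_((alpha,A),F), F finite.  Hence the n-th iterate of the shift is continuous
   at every point of length at least n, and being finitely defined means being
   clopen for the coarser notion "agree on a finite window".

   Continuity at x is checked entry by entry.  Entries of Phi(x) that are edges
   are locally constant, by (i) up to the length of x and by (iii) beyond it.  If
   Phi(x) = beta B B B ..., one shifts by |beta| <= |x| and has to treat
   Phi(x) = B B B ...: for infinite x, Phi^-1(BBB...) being finitely defined is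
   enough; for finite x, (ii)(a) gives D_B, and by (ii)(b) each excluded edge of
   eps(B) costs only finitely many edges of eps(A). *)
Require Import Defs.
From HB Require Import structures.
From mathcomp Require Import all_boot.
From mathcomp Require Import boolp classical_sets cardinality topology.

Set Implicit Arguments.
Unset Strict Implicit.
Unset Printing Implicit Defensive.

Local Open Scope classical_set_scope.

Lemma union_ofP (G : ultragraph) (K : set (set (ushift G))) (C : set (ushift G)) :
  union_of K C <-> forall x, C x -> exists P, [/\ K P, P x & P `<=` C].
Proof.
split=> [[K' K'K ->] x [P K'P Px]|KC].
  by exists P; split=> //; [exact: K'K | exact: bigcup_sup].
exists [set P | K P /\ P `<=` C] => [P []//|].
apply/seteqP; split=> [x /KC[P [KP Px PC]]|x [P [_ PC] Px]]; last exact: PC.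
by exists P.
Qed.

(** * Points of the shift space, letter by letter *)

Section points.
Variable G : ultragraph.
Implicit Types (x y : ushift G) (A : min_emitter G) (al : seq (edge G)).

Lemma ushift_inj x y : x =1 y -> x = y.
Proof.
case: x y => [x xP] [y yP] /= /funext xy.
by move: xP yP; rewrite xy => xP yP; rewrite (Prop_irrelevance xP yP).
Qed.

Lemma iter_shiftE n x m : iter n (@shift G) x m = x (n + m).
Proof. by elim: n m => //= n IHn m; rewrite IHn addnS. Qed.

Lemma iter_shift_const n A : iter n (@shift G) (const_pt A) = const_pt A.
Proof. by apply: ushift_inj => m; rewrite iter_shiftE. Qed.

Lemma fin_word_lt al A i : i < size al -> exists e, fin_word al A i = inl e.
Proof. by elim: al i => //= e al IHal [|i] => [_|/IHal//]; exists e. Qed.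

Lemma fin_word_ge al A i : size al <= i -> fin_word al A i = inr A.
Proof. by move=> ?; rewrite /fin_word nth_default ?size_map. Qed.

Lemma fin_word_inj al al' A A' :
  fin_word al A = fin_word al' A' -> al = al' /\ A = A'.
Proof.
elim: al al' => [|e al IHal] [|e' al'] alal'; have /= := congr1 (@^~ 0) alal' => //.
- by case.
- case=> <-; have /IHal[-> ->//] : fin_word al A = fin_word al' A'.
  by apply/funext => i; have := congr1 (@^~ i.+1) alal'.
Qed.

(** A finite point is presented below only by the equation [letters x = fin_word al A]; as this
    determines [al] and [A], the path and range conditions carry over to them. *)
Lemma fin_word_path x al A : letters x = fin_word al A ->
  is_path al /\ in_range al (emitter_set A).
Proof.
move=> xE; case: (lettersP x) => [[al' [A' [pal Aal]]]|[g _]]; rewrite xE.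
  by case/fin_word_inj=> -> ->.
by move/(congr1 (@^~ (size al))); rewrite fin_word_ge.
Qed.

Lemma ushift_cases x :
  (exists2 g : nat -> edge G, forall i, rng (g i) (src (g i.+1)) & x = inl \o g :> (_ -> _)) \/
  exists al A, letters x = fin_word al A.
Proof.
by case: (lettersP x) => [[al [A [_ _ xE]]]|]; [right; exists al, A|left].
Qed.

Lemma emitter_const x n m A : x n = inr A -> n <= m -> x m = inr A.
Proof.
case: (ushift_cases x) => [[g _ ->]//|[al [B ->]]] xn nm.
case: (ltnP n (size al)) => [/(fin_word_lt B)[e]|ln]; first by rewrite xn.
by move: xn; rewrite !fin_word_ge// (leq_trans ln).
Qed.

Lemma emitter0 x A : x 0 = inr A -> x = const_pt A.
Proof. by move=> x0; apply: ushift_inj => i; exact: emitter_const x0 _. Qed.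

Lemma edge_lt x n m e : x n = inl e -> m <= n -> exists f, x m = inl f.
Proof.
by move=> xn mn; case xm: (x m) => [f|B]; [exists f|rewrite (emitter_const xm) in xn].
Qed.

Lemma edge_follow x n e f : x n = inl e -> x n.+1 = inl f -> rng e (src f).
Proof.
case: (ushift_cases x) => [[g gP ->] /= [<-] [<-]//|[al [A xE]]].
have [pal _] := fin_word_path xE; rewrite xE => xn xn1.
have sn1 : n.+1 < size al.
  by rewrite ltnNge; apply/negP => le; rewrite fin_word_ge in xn1.
have sn : n < size al by exact: ltnW.
move: xn xn1; rewrite /fin_word !(nth_map e)// => -[ne] -[nf].
by have /(sortedP e)/(_ _ sn1)/asboolP := pal; rewrite ne nf.
Qed.

Lemma edge_emitter x n e A :
  x n = inl e -> x n.+1 = inr A -> emitter_set A `<=` rng e.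
Proof.
case: (ushift_cases x) => [[g gP ->]//|[al [B xE]]].
have [_] := fin_word_path xE; rewrite xE => Bal xn xn1.
have sn : n < size al.
  by rewrite ltnNge; apply/negP => le; rewrite fin_word_ge in xn.
have sn1 : size al = n.+1.
  apply/eqP; rewrite eqn_leq sn andbT leqNgt; apply/negP.
  by move=> /(fin_word_lt B)[f]; rewrite xn1.
rewrite -sn1 fin_word_ge// in xn1; case: xn1 => <-.
case: al Bal sn1 xn {sn xE} => //= f al Bal [<-].
by rewrite /fin_word (nth_map f)// nth_last /= => -[<-].
Qed.

(** Whatever follows an edge already lies in its range, so the ultrapath $(\alpha,r(\alpha))$
    constrains only the letters of $\alpha$. *)
Lemma prefix0_rng x n e : x n = inl e -> prefix0 (rng e) (iter n.+1 (@shift G) x).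
Proof.
move=> xn; rewrite /prefix0 iter_shiftE addn0.
case xn1: (x n.+1) => [f|A]; first exact: edge_follow xn xn1.
exact: edge_emitter xn xn1.
Qed.

(** A proper inclusion would put an infinite emitter strictly below the minimal [B]. This upgrades
    the inclusion in [prefix0] to an equality. *)
Lemma min_emitter_antisym A B : emitter_set A `<=` emitter_set B -> A = B.
Proof.
move=> AB; apply: val_inj; apply: contrapT => nAB.
have [[_ Bmin] [[Agen Ainf] _]] := (set_valP B, set_valP A).
apply: (Bmin (val A)) => //; split=> // BA.
by apply: nAB; apply/seteqP.
Qed.

End points.

(** * Windows, cylinders and neighbourhoods *)

Definition agree (G : ultragraph) (x : ushift G) n : set (ushift G) :=
  [set y | forall i, i < n -> y i = x i].

Section topology.
Variable G : ultragraph.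
Implicit Types (x y : ushift G) (A : min_emitter G) (al : seq (edge G)).

Lemma windowP x y k n :
  window y k n = window x k n <-> forall i, k <= i < k + n -> y i = x i.
Proof.
rewrite /window -eq_in_map; split=> yx i; have := yx i; rewrite mem_iota; exact.
Qed.

Lemma union_of_pseudo_cylinderP (C : set (ushift G)) :
  union_of (@pseudo_cylinder G) C <-> forall x, C x -> exists n, agree x n `<=` C.
Proof.
rewrite union_ofP; split=> CP x /CP.
  move=> [_ [[->//|[k [b [_ ->]]]] /= xb bC]]; exists (k + size b) => y yx.
  by apply: bC => /=; rewrite -[RHS]xb; apply/windowP => i /andP[_ /yx].
(* The window has length [n.+1] because a block is nonempty. *)
move=> [n nC]; exists [set y | window y 0 n.+1 = window x 0 n.+1]; split=> //.
  right; exists 0, (window x 0 n.+1); rewrite /is_block size_map size_iota.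
  by do 2!split=> //; exists x, 0.
by move=> y /windowP yx; apply: nC => i ni; apply: yx; rewrite leqW.
Qed.

Lemma gen_cylinder_open (D : set (ushift G)) : gen_cylinder D -> open D.
Proof.
move=> gD; exists [set D]; last by rewrite bigcup_set1.
by move=> _ ->; exact: (@finI_from1 _ _ _ id).
Qed.

(** Cylinders are so far only a subbase, and a filter absorbs the finite intersections. Applied to
    the filter generated by a candidate base at [x], this shows that every neighbourhood contains a
    member of it. *)
Lemma gen_cylinder_cvg x (F : set_system (ushift G)) {FF : Filter F} :
  (forall D, gen_cylinder D -> D x -> F D) -> nbhs x `<=` F.
Proof.
move=> gF U; rewrite nbhsE => -[_ [[K KI <-] [V KV Vx]] VU].
have [E Egen EV] := KI _ KV.
apply: (@filterS _ _ _ V) => [y Vy|]; first by apply: VU; exists V.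
rewrite -EV; apply: filter_bigI => D DE; apply: gF; first exact/set_mem/Egen.
by move: Vx; rewrite -EV; apply.
Qed.

Lemma cylinderP al (B : set (vertex G)) F x : cylinder (al, B) F x <->
  [/\ forall e i, i < size al -> x i = inl (nth e al i),
      prefix0 B (iter (size al) (@shift G) x) & ~ (inl @` F) (x (size al))].
Proof.
split=> [[[/= xal xB] xF]|[xal xB xF]]; (split=> //; last 1 first).
  move=> e i ial; have := congr1 (fun s => nth (inl e) s i) xal.
  by rewrite /window (nth_map 0) ?size_iota// nth_iota// (nth_map e).
split=> //; case alE: {-}al => [|e ?] /=; first by rewrite alE.
apply: (@eq_from_nth _ (inl e)); rewrite !size_map ?size_iota// => i ial.
by rewrite (nth_map 0) ?size_iota// nth_iota// (nth_map e)// -xal.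
Qed.

(** After [al] comes an edge emitted from [A] or a minimal emitter inside [A]; by minimality the
    latter is [A], and the point is [x]. *)
Lemma cylinder_finP x al A F y : letters x = fin_word al A ->
  cylinder (al, emitter_set A) F y <->
  agree x (size al) y /\
  (y = x \/ exists2 e, (emitted (emitter_set A) `\` F) e & y (size al) = inl e).
Proof.
move=> xE; have xal : x (size al) = inr A by rewrite xE fin_word_ge.
have agE : (forall e i, i < size al -> y i = inl (nth e al i)) <-> agree x (size al) y.
  split=> [yal i ial|yx e i ial]; last by rewrite yx// xE /fin_word (nth_map e).
  by have [e xi] := fin_word_lt A ial; rewrite (yal e)// xE /fin_word (nth_map e).
rewrite cylinderP (propext agE); split=> [[yx yA yF]|[yx yA]]; split=> //.
- move: yA yF; rewrite /prefix0 iter_shiftE addn0.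
  case yal: (y (size al)) => [e|B] BA nF.
    by right; exists e => //; split=> // Fe; apply: nF; exists e.
  left; have {}yal : y (size al) = inr A by rewrite yal (min_emitter_antisym BA).
  apply: ushift_inj => i; case: (ltnP i (size al)) => [/yx//|ali].
  by rewrite (emitter_const yal)// (emitter_const xal).
- rewrite /prefix0 iter_shiftE addn0.
  by case: yA => [->|[e [Ae _] ->]//]; rewrite xal.
- case: yA => [->|[e [_ nFe] ->]] [f Ff]; first by rewrite xal.
  by case=> fe; rewrite fe in Ff.
Qed.

Lemma ultrapath_fin x al A : letters x = fin_word al A ->
  ultrapath (al, emitter_set A).
Proof.
by case/fin_word_path => pal Aal; split=> //; case: (set_valP A) => [[]].
Qed.

(** The ultrapath is the initial path of [x] together with the range of its last edge. *)
Lemma gen_cylinder_agree x n e : x n = inl e -> gen_cylinder (agree x n.+1).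
Proof.
(* All letters before index [n] are edges because the one at [n] is, so the default [e] is never
   taken. *)
move=> xn; pose al := mkseq (fun i => if x i is inl f then f else e) n.+1.
have alE i : i < n.+1 -> x i = inl (nth e al i).
  move=> ni; rewrite nth_mkseq//.
  by have [f ->] := edge_lt xn ni.
have sal : size al = n.+1 by rewrite size_mkseq.
clearbody al; exists (al, rng e), set0; split=> //=.
- split=> /=.
  + apply/(sortedP e) => i; rewrite sal => ni.
    by apply/asboolP/(@edge_follow _ x i); rewrite alE// ltnW.
  + by apply: sub_gen_smallest; right; exists e.
  + move: sal (alE n (ltnSn n)); rewrite xn => + [->].
    by case: (al) => //= f al' [<-]; rewrite -last_nth.
apply/seteqP; split=> y.
  move=> yx; apply/cylinderP; rewrite sal; split=> [f i ni||[] //].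
    by rewrite yx// alE// (set_nth_default f) ?sal.
  by apply: prefix0_rng; rewrite yx.
case/cylinderP; rewrite sal => yal _ _ i ni.
by rewrite (yal e)// alE.
Qed.

Lemma cylinder_agree x al (B : set (vertex G)) F :
  cylinder (al, B) F x -> agree x (size al).+1 `<=` cylinder (al, B) F.
Proof.
case/cylinderP=> xal xB xF y yx; apply/cylinderP; split.
- by move=> e i ial; rewrite yx 1?ltnW// (xal e).
- by move: xB; rewrite /prefix0 !iter_shiftE addn0 yx.
- by rewrite yx.
Qed.

(** A cylinder depends on finitely many letters. The converse can fail at a finite [x], where a
    window reaching beyond its length contains [x] alone. *)
Lemma nbhs_agree x U : nbhs x U -> exists n, agree x n `<=` U.
Proof.
move=> xU; suff [n _ nU] : filter_from setT (agree x) U by exists n.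
apply: gen_cylinder_cvg xU; first apply: filter_from_filter.
- by exists 0.
- move=> n m _ _; exists (maxn n m) => // y yx.
  by split=> i im; apply: yx; rewrite leq_max im ?orbT.
- move=> _ [[al B] [F [_ _ _ ->]]] /cylinder_agree alF.
  by exists (size al).+1.
Qed.

Lemma nbhs_infP x U : (forall i, exists e, x i = inl e) ->
  nbhs x U <-> exists n, agree x n `<=` U.
Proof.
move=> xE; split=> [/nbhs_agree//|[n nU]].
have [e xn] := xE n; apply: (@filterS _ _ _ (agree x n.+1)).
  by move=> y yx; apply: nU => i ni; apply: yx; rewrite leqW.
by apply: open_nbhs_nbhs; split=> //; exact/gen_cylinder_open/(gen_cylinder_agree xn).
Qed.

(** The path [be] cannot outrun the edges of [x]. If it is shorter than [al], membership is decided
    by letters of [al]; if the lengths agree, [A] lies in [B], so every edge emitted from [A] and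
    outside [F] is allowed. *)
Lemma cylinder_refine x al A be B F : letters x = fin_word al A ->
  cylinder (be, B) F x ->
  cylinder (al, emitter_set A) (F `&` emitted (emitter_set A)) `<=` cylinder (be, B) F.
Proof.
move=> xE xF y /(cylinder_finP _ _ xE)[yx yA].
have xal : x (size al) = inr A by rewrite xE fin_word_ge.
have beal : size be <= size al.
  rewrite leqNgt; apply/negP => alb; case/cylinderP: xF => /[swap] _ xbe _.
  case: be alb xbe => // e be alb /(_ e _ alb).
  by rewrite xal.
have [lt_beal|] := ltnP (size be) (size al).
  by apply: (cylinder_agree xF) => i ib; apply: yx; exact: leq_trans lt_beal.
move=> albe; have {albe}eq_beal : size be = size al by apply/eqP; rewrite eqn_leq beal.
case: yA => [->//|[e [Ae nFe] yal]].
case/cylinderP: xF => xbe xB _; apply/cylinderP; split.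
- by move=> f i ib; rewrite yx -?eq_beal// (xbe f).
- move: xB; rewrite /prefix0 !iter_shiftE addn0 eq_beal xal yal; exact.
- by rewrite eq_beal yal => -[f Ff [fe]]; apply: nFe; rewrite -fe; split=> //; rewrite fe.
Qed.

Lemma nbhs_finP x al A U : letters x = fin_word al A ->
  nbhs x U <-> exists F, [/\ finite_set F, F `<=` emitted (emitter_set A) &
    cylinder (al, emitter_set A) F `<=` U].
Proof.
move=> xE; split=> [xU|[F [finF FA FU]]]; last first.
  apply: (@filterS _ _ _ _ U FU); apply: open_nbhs_nbhs; split.
    by apply: gen_cylinder_open; exists (al, emitter_set A), F; split=> //; exact: ultrapath_fin xE.
  by apply/(cylinder_finP _ _ xE); split=> //; left.
suff [F [finF FA] FU] : filter_from
    [set F | finite_set F /\ F `<=` emitted (emitter_set A)]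
    (cylinder (al, emitter_set A)) U by exists F.
apply: gen_cylinder_cvg xU; first apply: filter_from_filter.
- by exists set0; split; [exact: finite_set0 | exact: sub0set].
- move=> F1 F2 [fF1 F1A] [fF2 F2A]; exists (F1 `|` F2).
    by split; [rewrite finite_setU | rewrite subUset].
  move=> y /(cylinder_finP _ _ xE)[yx yA].
  split; apply/(cylinder_finP _ _ xE); split=> //;
    case: yA => [|[e [Ae nF] ye]]; [by left| |by left|];
    right; exists e => //; split=> // Fe; apply: nF; [left|right]; exact: Fe.
- move=> _ [[be B] [F [_ fF _ ->]]] /(cylinder_refine xE) FD.
  by exists (F `&` emitted (emitter_set A)) => //; split; [exact: finite_setIl | exact: subIsetr].
Qed.

(** By the two descriptions of neighbourhoods, cylinders form a base and not just a subbase.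
    Condition (i) thus says that the sets $C_a$, $a\in\mathcal{H}^1$, are open. *)
Lemma union_of_gen_cylinderP (C : set (ushift G)) :
  union_of gen_cylinder C <-> open C.
Proof.
rewrite union_ofP; split=> [CP|oC x Cx].
  rewrite openE /= => x /CP [D [/gen_cylinder_open oD Dx DC]].
  by apply: filterS DC _; exact: open_nbhs_nbhs.
have xC : nbhs x C by exact: open_nbhs_nbhs.
case: (ushift_cases x) => [[g _ xE]|[al [A xE]]].
  have xe i : exists e, x i = inl e by exists (g i); rewrite xE.
  have /(nbhs_infP _ xe)[n nC] := xC; have [e xn] := xe n.
  exists (agree x n.+1); split=> //; first exact: gen_cylinder_agree xn.
  by move=> y yx; apply: nC => i ni; apply: yx; rewrite leqW.
have /(nbhs_finP _ xE)[F [fF FA FC]] := xC.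
exists (cylinder (al, emitter_set A) F); split=> //.
  by exists (al, emitter_set A), F; split=> //; exact: ultrapath_fin xE.
by apply/(cylinder_finP _ _ xE); split=> //; left.
Qed.

(** Deleting a first edge shortens a window by one, or strips the head of [al] while keeping [A] and
    [F]. At $(AAA\ldots)$ the shift need not be continuous. *)
Lemma nbhs_shift1 x U e : x 0 = inl e ->
  nbhs (shift x) U -> nbhs x (@shift G @^-1` U).
Proof.
move=> x0; case: (ushift_cases x) => [[g _ xE]|[al [A xE]]].
  have xe i : exists f, x i = inl f by exists (g i); rewrite xE.
  have sxe i : exists f, shift x i = inl f by exact: xe.
  move/(nbhs_infP _ sxe) => [n nU]; apply/(nbhs_infP _ xe); exists n.+1 => y yx.
  by apply: nU => i; exact: (yx i.+1).
case: al xE => [|f al] xE; first by rewrite xE in x0.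
have sxE : letters (shift x) = fin_word al A by apply/funext => i /=; rewrite xE.
move/(nbhs_finP _ sxE) => [F [fF FA FU]]; apply/(nbhs_finP _ xE); exists F; split=> //.
move=> y /(cylinder_finP _ _ xE)[yx yA]; apply: FU; apply/(cylinder_finP _ _ sxE).
split; first by move=> i; exact: (yx i.+1).
by case: yA => [->|[h Fh yh]]; [left|right; exists h].
Qed.

Lemma nbhs_shift x U n : (forall i, i < n -> exists e, x i = inl e) ->
  nbhs (iter n (@shift G) x) U -> nbhs x (iter n (@shift G) @^-1` U).
Proof.
elim: n U => // n IHn U xe xU.
have [e xn] := xe n (ltnSn n).
apply: (IHn (@shift G @^-1` U)) => [i /ltnW/xe//|].
by apply: (nbhs_shift1 (e := e)) xU; rewrite iter_shiftE addn0.
Qed.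

Lemma open_letter0 (a : edge G) : open [set x : ushift G | x 0 = inl a].
Proof.
rewrite openE /= => x x0; apply: (@filterS _ _ _ (agree x 1)).
  by move=> y /(_ 0) /= ->.
by apply: open_nbhs_nbhs; split=> //; exact/gen_cylinder_open/(gen_cylinder_agree x0).
Qed.

Lemma const_nbhs A F : finite_set F -> F `<=` emitted (emitter_set A) ->
  nbhs (const_pt A) (cylinder ([::], emitter_set A) F).
Proof.
have AE : letters (const_pt A) = fin_word [::] A.
  by apply/funext => i; rewrite fin_word_ge.
by move=> fF FA; apply/(nbhs_finP _ AE); exists F; split.
Qed.

Lemma const_cylinderP A F y : cylinder ([::], emitter_set A) F y <->
  y 0 = inr A \/ exists2 e, (emitted (emitter_set A) `\` F) e & y 0 = inl e.
Proof.
have AE : letters (const_pt A) = fin_word [::] A.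
  by apply/funext => i; rewrite fin_word_ge.
split=> [/(cylinder_finP _ _ AE)[_ [->|]]|yA]; [by left|by right|].
apply/(cylinder_finP _ _ AE); split=> //.
by case: yA => [/emitter0|]; [left|right].
Qed.

End topology.

(* Condition (ii) of the theorem. *)
Definition emitter_condition (G H : ultragraph) (Phi : ushift G -> ushift H) : Prop :=
  forall (xb : ushift G) al (A : min_emitter G) (B : min_emitter H),
    letters xb = fin_word al A -> Phi xb = const_pt B ->
    (exists F : set (edge G),
      [/\ finite_set F, F `<=` emitted (emitter_set A) &
        forall e : edge G, (emitted (emitter_set A) `\` F) e ->
        forall x : ushift G,
          (forall i, (i < size al)%N -> x i = xb i) ->
          x (size al) = inl e ->
          Phi x 0 = inr B \/ (inl @` emitted (emitter_set B)) (Phi x 0)]) /\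
    (forall x : ushift G,
      (forall i, (i < size al)%N -> x i = xb i) ->
      (inl @` emitted (emitter_set A)) (x (size al)) ->
      (inl @` emitted (emitter_set B)) (Phi x 0) ->
      finite_set [set g : edge G | emitted (emitter_set A) g /\
        exists y : ushift G,
          [/\ forall i, (i < size al)%N -> y i = xb i,
              y (size al) = inl g & Phi y 0 = Phi x 0]]).

(* Condition (iii) of the theorem. *)
Definition edge_condition (G H : ultragraph) (Phi : ushift G -> ushift H)
    (C : alphabet H -> set (ushift G)) : Prop :=
  forall (A : min_emitter G) (d : edge H), (forall n, Phi (const_pt A) n = inl d) ->
    forall M, (1 <= M)%N -> exists F : set (edge G),
      [/\ finite_set F, F `<=` emitted (emitter_set A) &
        forall i, (i <= M)%N ->
          iter i (@shift G) @` cylinder ([::], emitter_set A) F `<=` C (inl d)].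

Lemma iter_shift_commuting (G H : ultragraph) (Phi : ushift G -> ushift H)
  n (x : ushift G) :
  shift_commuting Phi -> Phi (iter n (@shift G) x) = iter n (@shift H) (Phi x).
Proof.
move=> comm; elim: n => //= n <-.
by have := congr1 (@^~ (iter n (@shift G) x)) comm.
Qed.

(** * From continuity and shift commutation to the code *)

Section continuous_to_code.
Variables (G H : ultragraph) (Phi : ushift G -> ushift H).
Implicit Types (x y : ushift G) (A : min_emitter G) (B : min_emitter H).
Hypothesis hPhi : forall B : min_emitter H,
  finitely_defined (Phi @^-1` [set const_pt B]).
Hypothesis cPhi : continuous Phi.
Hypothesis sPhi : shift_commuting Phi.

(** The symbolic sum at $n=1$ leaves no other choice of partition. *)
Let C (a : alphabet H) : set (ushift G) := [set x | Phi x 0 = a].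

Lemma letter0_inr B : C (inr B) = Phi @^-1` [set const_pt B].
Proof. by apply/seteqP; split=> [x /emitter0//|x]; rewrite /C /= => ->. Qed.

Lemma letter0_open a : open (C (inl a)).
Proof. by have /continuousP/(_ _ (open_letter0 a)) := cPhi. Qed.

(** For an edge letter, continuity gives a neighbourhood, which contains a window; for an emitter
    letter, $\Phi^{-1}(BBB\ldots)$ is finitely defined. *)
Lemma letter0_agree x : exists n, agree x n `<=` C (Phi x 0).
Proof.
case Px: (Phi x 0) => [a|B].
  by apply/nbhs_agree/open_nbhs_nbhs; split=> //; exact: letter0_open.
have [/union_of_pseudo_cylinderP CB _] := hPhi B.
by have := CB x (emitter0 Px); rewrite letter0_inr.
Qed.

Lemma letter0_code : gen_sliding_block_code Phi C.
Proof.
split.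
- split; last by apply/seteqP; split=> // x _; exists (Phi x 0).
  by move=> a b _ _ [x [<- <-]].
- move=> a; split; apply/union_of_pseudo_cylinderP => x.
    by move=> <-; exact: letter0_agree.
  (* The same window serves the complement: on it the first letter of the image stays the one at
     [x], hence differs from [a]. *)
  move=> xa; have [n nx] := letter0_agree x; exists n => y yx ya; apply: xa.
  by rewrite /C /= -[LHS](nx y yx).
- by move=> x n a; rewrite /C /= iter_shift_commuting// iter_shiftE addn0.
Qed.

(** Both halves of (ii) are continuity at [xb], read on the edges that can follow [al]: (a) with
    $V=D_B$, (b) with a letter excluded. *)
Lemma continuous_fin xb al A V : letters xb = fin_word al A ->
  nbhs (Phi xb) V -> exists F, [/\ finite_set F, F `<=` emitted (emitter_set A) &
    forall e x, (emitted (emitter_set A) `\` F) e -> agree xb (size al) x ->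
      x (size al) = inl e -> V (Phi x)].
Proof.
move=> xE /cPhi /(nbhs_finP _ xE)[F [fF FA FV]]; exists F; split=> // e x Fe xxb xe.
by apply: FV; apply/(cylinder_finP _ _ xE); split=> //; right; exists e.
Qed.

Lemma continuous_emitter_condition : emitter_condition Phi.
Proof.
move=> xb al A B xE PxB; split.
  have /(continuous_fin xE)[F [fF FA FV]] :
      nbhs (Phi xb) (cylinder ([::], emitter_set B) set0).
    by rewrite PxB; apply: const_nbhs => //; exact: sub0set.
  exists F; split=> // e Fe x xxb xe.
  have /const_cylinderP[->|[f [Bf _] ->]] := FV e x Fe xxb xe; [by left|right].
  by exists f.
move=> x _ _ [f Bf fE].
(* With $V=D_{B,\{f\}}$ and $f=(\Phi(x))_1$, no edge of $\varepsilon(A)$ outside [F] leads to an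
   image starting with [f]; so $A_x\subseteq F$. *)
have /(continuous_fin xE)[F [fF FA FV]] :
    nbhs (Phi xb) (cylinder ([::], emitter_set B) [set f]).
  by rewrite PxB; apply: const_nbhs => // _ ->.
apply: sub_finite_set fF => g [Ag [y [yx yg Pyx]]].
apply: contrapT => nFg.
have /const_cylinderP := FV g y (conj Ag nFg) yx yg.
by rewrite Pyx -fE => -[//|[h [_ hf] [/esym]]].
Qed.

Lemma continuous_edge_condition : edge_condition Phi C.
Proof.
move=> A d PAd M _.
have AE : letters (const_pt A) = fin_word [::] A.
  by apply/funext => i; rewrite fin_word_ge.
(* Agreement on [M.+1] entries covers the shifts $0,\ldots,M$. *)
have : nbhs (Phi (const_pt A)) (agree (Phi (const_pt A)) M.+1).
  by apply/nbhs_infP; [move=> i; exists d | exists M.+1].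
move/cPhi/(nbhs_finP _ AE) => [F [fF FA FV]]; exists F; split=> // i iM _ [x xF <-].
rewrite /C /= iter_shift_commuting// iter_shiftE addn0.
by rewrite (FV x xF)// PAd.
Qed.

End continuous_to_code.

(** * From the code and conditions (i)-(iii) to continuity *)

Section code_to_continuous.
Variables (G H : ultragraph) (Phi : ushift G -> ushift H).
Implicit Types (x y : ushift G) (A : min_emitter G) (B : min_emitter H).
Variable C : alphabet H -> set (ushift G).
Hypothesis hPhi : forall B : min_emitter H,
  finitely_defined (Phi @^-1` [set const_pt B]).
Hypothesis codeE : forall x n a, Phi x n = a <-> C a (iter n (@shift G) x).

(** The letter of $\Phi(\sigma(x))$ at index [n] and that of $\Phi(x)$ at index [n.+1] are both read
    off the part containing $\sigma^{n+1}(x)$. *)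
Lemma code_shift_commuting : shift_commuting Phi.
Proof.
apply/funext => x; apply: ushift_inj => n /=.
by apply/codeE; rewrite -iterSr; apply/codeE.
Qed.

Lemma code_iter x n m : Phi (iter n (@shift G) x) m = Phi x (n + m).
Proof. by rewrite iter_shift_commuting ?iter_shiftE//; exact: code_shift_commuting. Qed.

Hypothesis openC : forall a, open (C (inl a)).
Hypothesis emC : emitter_condition Phi.
Hypothesis edC : edge_condition Phi C.

(** Here [n] is at most the length of [x], so $\sigma^n$ is continuous at [x] and pulls the open set
    $C_a$ back to a neighbourhood. *)
Lemma nbhs_code_letter x n a : (forall i, i < n -> exists e, x i = inl e) ->
  Phi x n = inl a -> nbhs x [set y | Phi y n = inl a].
Proof.
move=> xe /codeE Ca.
apply: (@filterS _ _ _ (iter n (@shift G) @^-1` C (inl a))) => [y /codeE//|].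
by apply: nbhs_shift => //; exact: open_nbhs_nbhs.
Qed.

(** A fixed point of the shift is sent to a fixed point; one edge entry thus yields the hypothesis
    of (iii). *)
Lemma code_const_letter A n : Phi (const_pt A) n = Phi (const_pt A) 0.
Proof. by rewrite -[n]addn0 -code_iter iter_shift_const. Qed.

Lemma code_emitter x n m A : x n = inr A -> n <= m ->
  Phi x m = Phi (const_pt A) 0.
Proof.
move=> xn nm; rewrite -(subnKC nm) -code_iter.
rewrite (@emitter0 _ (iter n (@shift G) x) A) ?iter_shiftE ?addn0//.
exact: code_const_letter.
Qed.

(* Condition (iii) takes over from (i) at the entries beyond the length of [x],
   where the iterates of the shift stop being continuous. *)
Lemma nbhs_code_edge x n a : Phi x n = inl a -> nbhs x [set y | Phi y n = inl a].
Proof.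
move=> Pxn; case: (ushift_cases x) => [[g _ xE]|[al [A xE]]].
  by apply: nbhs_code_letter => // i _; exists (g i); rewrite xE.
have xal : x (size al) = inr A by rewrite xE fin_word_ge.
have [nal|aln] := leqP n (size al).
  apply: nbhs_code_letter => // i ni; rewrite xE.
  by apply: fin_word_lt; exact: leq_trans nal.
have PA m : Phi (const_pt A) m = inl a.
  by rewrite code_const_letter -Pxn (code_emitter xal)// ltnW.
have n_gt0 : 0 < n by exact: leq_trans aln.
(* $M=n$ is ample: once $\sigma^{|al|}$ has brought a point into $D_{A,F}$, only $n-|al|\leq n$
   shifts remain. *)
have [F [fF FA FC]] := edC PA n_gt0.
have xF : nbhs x (iter (size al) (@shift G) @^-1` cylinder ([::], emitter_set A) F).
  apply: nbhs_shift => [i ial|]; first by rewrite xE; exact: fin_word_lt.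
  rewrite (@emitter0 _ (iter (size al) (@shift G) x) A); first exact: const_nbhs.
  by rewrite iter_shiftE addn0.
apply: filterS xF => y yF; apply/codeE.
rewrite -(subnK (ltnW aln)) iterD; apply: (FC _ (leq_subr _ _)).
by exists (iter (size al) (@shift G) y).
Qed.

Lemma nbhs_code_agree x n : (forall m, m < n -> exists a, Phi x m = inl a) ->
  nbhs x (Phi @^-1` agree (Phi x) n).
Proof.
elim: n => [_|n IHn xn]; first by apply: (@filterS _ _ _ setT) => //; exact: filterT.
have xP : nbhs x (Phi @^-1` agree (Phi x) n) by apply: IHn => m /ltnW; exact: xn.
have [a Pxn] := xn n (ltnSn n).
apply: filterS2 xP (nbhs_code_edge Pxn) => y yx ynx i; rewrite ltnS leq_eqVlt.
by case/predU1P => [->|/yx//]; rewrite Pxn.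
Qed.

Lemma nbhs_code_const x B F : finite_set F -> F `<=` emitted (emitter_set B) ->
  Phi x = const_pt B -> nbhs x (Phi @^-1` cylinder ([::], emitter_set B) F).
Proof.
move=> fF FB PxB; case: (ushift_cases x) => [[g _ xE]|[al [A xE]]].
  have [/union_of_pseudo_cylinderP/(_ x PxB)[n nB] _] := hPhi B.
  apply/nbhs_infP; first by move=> i; exists (g i); rewrite xE.
  by exists n => y /nB /= ->; apply/const_cylinderP; left.
have [[F0 [fF0 F0A F0B]] Afin] := emC xE PxB.
(* These are the sets $A_x$ of (b), indexed by the image letter [f]: finite by (b) if some point
   realizes [f], and empty otherwise. *)
pose fiber f := [set g | emitted (emitter_set A) g /\ exists y : ushift G,
  [/\ forall i, i < size al -> y i = x i, y (size al) = inl g & Phi y 0 = inl f]].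
have fib f : F f -> finite_set (fiber f).
  move=> Ff; have [[g [Ag [y [yx yg Pyf]]]]|nf] := pselect (exists g, fiber f g).
    by rewrite /fiber -Pyf; apply: Afin => //; [exists g|exists f => //; exact: FB].
  rewrite (_ : fiber f = set0); first exact: finite_set0.
  by apply/seteqP; split=> // g fg; apply: nf; exists g.
(* Leaving out [F0] keeps the image in $D_B$; leaving out the fibers keeps its first letter out of
   [F]. *)
apply/(nbhs_finP _ xE); exists (F0 `|` \bigcup_(f in F) fiber f); split.
- by rewrite finite_setU; split=> //; exact: bigcup_finite.
- by rewrite subUset; split=> // g [f _ []].
move=> y /(cylinder_finP _ _ xE)[yx [->|[g [Ag nFg] yg]]]; apply/const_cylinderP.
  by left; rewrite PxB.
have [|Pyh|[f Bf Pyf]] := F0B g _ y yx yg; [|by left|right].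
  by split=> // F0g; apply: nFg; left.
exists f => //; split=> // Ff; apply: nFg; right; exists f => //.
by split=> //; exists y.
Qed.

Lemma code_continuous : continuous Phi.
Proof.
move=> x V PxV; rewrite /nbhs /=.
case: (ushift_cases (Phi x)) => [[h _ PxE]|[be [B PxE]]].
  have Pxe i : exists a, Phi x i = inl a by exists (h i); rewrite PxE.
  have /(nbhs_infP _ Pxe)[n nV] := PxV.
  by apply: filterS (nbhs_code_agree _) => [y /nV|m _].
have /(nbhs_finP _ PxE)[F [fF FB FV]] := PxV.
have Pxe i : i < size be -> exists a, Phi x i = inl a.
  by rewrite PxE; exact: fin_word_lt.
have Pxbe : Phi x (size be) = inr B by rewrite PxE fin_word_ge.
(* This is $|be|\leq|x|$: an emitter letter of [x] at [i] would make $\Phi(x)$ constant from [i] on,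
   yet it has an edge at [i] and [B] at [size be]. *)
have xe i : i < size be -> exists e, x i = inl e.
  move=> ibe; case xi: (x i) => [e|A]; first by exists e.
  have [a] := Pxe i ibe.
  by rewrite (code_emitter xi)// -(code_emitter xi (ltnW ibe)) Pxbe.
have xF : nbhs (iter (size be) (@shift G) x)
    (Phi @^-1` cylinder ([::], emitter_set B) F).
  by apply: nbhs_code_const => //; apply: emitter0; rewrite code_iter addn0.
apply: filterS2 (nbhs_code_agree Pxe) (nbhs_shift xe xF) => y yx yF.
apply: FV; apply/(cylinder_finP _ _ PxE); split=> //.
(* After [be], the image of [y] shows either [B], which forces it to equal $\Phi(x)$, or an edge of
   $\varepsilon(B)$ outside [F]. *)
move: yF => /const_cylinderP; rewrite code_iter addn0 => -[Pyb|]; [left|by right].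
apply: ushift_inj => i; case: (ltnP i (size be)) => [/yx//|bei].
by rewrite (emitter_const Pyb)// (emitter_const Pxbe).
Qed.

End code_to_continuous.

Theorem theorem3p21 (G H : ultragraph) (hG : no_sinks G) (hH : no_sinks H)
    (Phi : ushift G -> ushift H)
    (hPhi : forall B : min_emitter H,
       finitely_defined (Phi @^-1` [set const_pt B])) :
  (continuous Phi /\ shift_commuting Phi) <->
  exists C : alphabet H -> set (ushift G),
    (forall B : min_emitter H, C (inr B) = Phi @^-1` [set const_pt B]) /\
    gen_sliding_block_code Phi C /\
    (* (i) *)
    (forall a : edge H, union_of gen_cylinder (C (inl a))) /\
    (* (ii) *)
    (forall (xb : ushift G) (al : seq (edge G)) (A : min_emitter G)
        (B : min_emitter H),
      letters xb = fin_word al A -> Phi xb = const_pt B ->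
      (* (a) *)
      (exists F : set (edge G),
        [/\ finite_set F, F `<=` emitted (emitter_set A) &
          forall e : edge G, (emitted (emitter_set A) `\` F) e ->
          forall x : ushift G,
            (forall i, (i < size al)%N -> x i = xb i) ->
            x (size al) = inl e ->
            Phi x 0 = inr B \/ (inl @` emitted (emitter_set B)) (Phi x 0)]) /\
      (* (b) *)
      (forall x : ushift G,
        (forall i, (i < size al)%N -> x i = xb i) ->
        (inl @` emitted (emitter_set A)) (x (size al)) ->
        (inl @` emitted (emitter_set B)) (Phi x 0) ->
        finite_set [set g : edge G | emitted (emitter_set A) g /\
          exists y : ushift G,
            [/\ forall i, (i < size al)%N -> y i = xb i,
                y (size al) = inl g & Phi y 0 = Phi x 0]])) /\
    (* (iii) *)
    (forall (A : min_emitter G) (d : edge H),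
      (forall n, Phi (const_pt A) n = inl d) ->
      forall M : nat, (1 <= M)%N ->
      exists F : set (edge G),
        [/\ finite_set F, F `<=` emitted (emitter_set A) &
          forall i, (i <= M)%N ->
            iter i (@shift G) @` cylinder ([::], emitter_set A) F `<=` C (inl d)]).
Proof.
split=> [[cPhi sPhi]|[C [_ [[_ _ codeE] [opC cond]]]]].
  exists (fun a => [set x | Phi x 0 = a]); split; last split; last split.
  - exact: letter0_inr.
  - exact: letter0_code.
  - by move=> a; apply/union_of_gen_cylinderP; exact: letter0_open.
  - split; last exact: continuous_edge_condition.
    exact: continuous_emitter_condition.
have {}opC a : open (C (inl a)) by exact/union_of_gen_cylinderP.
by split; [case: cond => emC edC; exact: code_continuous | exact: code_shift_commuting codeE].
Qed.
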